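(* Let $n\ge 2$, let $K_1,K_2\subset\mathbb{R}^n$ be proper cones, and let $L(A)=XAY$ be a linear map on $M_n$ for fixed $X,Y\in M_n$. Then $L(MS(K_1,K_2)) = MS(K_1,K_2)$ if and only if either $X(K_2)=K_2$ and $Y(K_1)=K_1$, or $-X(K_2)=K_2$ and $-Y(K_1)=K_1$.
   Context: $M_n$ is the space of real $n\times n$ matrices. A convex cone $K\subseteq\mathbb{R}^n$ is a set with $K+K\subseteq K$ and $\alpha K\subseteq K$ for all $\alpha\ge 0$; it is proper if it is closed, pointed ($K\cap -K=\{0\}$) and has nonempty interior $K^\circ$. A matrix $A\in M_n$ is $(K_1,K_2)$-semipositive if there exists $x\in K_1^\circ$ with $Ax\in K_2^\circ$. It is $(K_1,K_2)$-minimally semipositive if it is $(K_1,K_2)$-semipositive and has a left inverse $B\in M_n$ ($BA=I_n$) with $B(K_2)\subseteq K_1$; the set of such matrices is $MS(K_1,K_2)$. *)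

(* Defs.v *)
From HB Require Import structures.
From mathcomp Require Import all_boot all_order all_algebra.
From mathcomp Require Import all_classical all_reals all_analysis.

Set Implicit Arguments.
Unset Strict Implicit.
Unset Printing Implicit Defensive.

Import Order.TTheory GRing.Theory Num.Theory.
Import numFieldNormedType.Exports.

Local Open Scope classical_set_scope.
Local Open Scope ring_scope.

Definition convex_cone (R : realType) (n : nat) (K : set 'cV[R]_n) : Prop :=
  (forall x y : 'cV[R]_n, K x -> K y -> K (x + y)) /\
  (forall (a : R) (x : 'cV[R]_n), 0 <= a -> K x -> K (a *: x)).

Definition proper_cone (R : realType) (n : nat) (K : set 'cV[R]_n) : Prop :=
  [/\ convex_cone K,
      closed K,
      K `&` [set - x | x in K] = [set 0] &
      interior K !=set0].

Definition mximage (R : realType) (n : nat) (A : 'M[R]_n) (K : set 'cV[R]_n) :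
    set 'cV[R]_n :=
  [set A *m x | x in K].

Definition semipositive (R : realType) (n : nat) (K1 K2 : set 'cV[R]_n)
    (A : 'M[R]_n) : Prop :=
  exists2 x : 'cV[R]_n, interior K1 x & interior K2 (A *m x).

Definition minimally_semipositive (R : realType) (n : nat)
    (K1 K2 : set 'cV[R]_n) (A : 'M[R]_n) : Prop :=
  semipositive K1 K2 A /\
  exists2 B : 'M[R]_n, B *m A = 1%:M & mximage B K2 `<=` K1.

Definition MS (R : realType) (n : nat) (K1 K2 : set 'cV[R]_n) :
    set 'M[R]_n :=
  [set A | minimally_semipositive K1 K2 A].

(* Main.v *)
Require Import Defs.
From mathcomp Require Import all_boot all_order all_algebra.
From mathcomp Require Import all_classical all_reals all_analysis.
From mathcomp Require Import ring lra.

Set Implicit Arguments.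
Unset Strict Implicit.
Unset Printing Implicit Defensive.

Import Order.TTheory GRing.Theory Num.Theory.
Import numFieldNormedType.Exports.

Local Open Scope classical_set_scope.
Local Open Scope ring_scope.

(** Passing to inverses makes the problem transparent.  If [A] has a left
    inverse mapping [K2] into [K1], then [A] is invertible and its inverse maps
    the interior of [K2] into the interior of [K1], so semipositivity comes for
    free: [MS K1 K2] is the set of inverses of the invertible matrices [B] with
    [B K2] contained in [K1] ([MSP]).  For invertible [X] and [Y], the equality
    [X MS Y = MS] therefore says that an invertible [B] maps [K2] into [K1] if
    and only if [Y^-1 B X^-1] does ([unit_image_MS]).  The invertibility of [X]
    and [Y] follows from the surjectivity onto [MS], which is nonempty
    ([exists_unit_cone_map]).

    The converse implication of the theorem is then immediate.  For the direct
    one, put [P = Y^-1] and [Q = X^-1].  Invertible matrices are dense among the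
    [B] with [B K2] contained in [K1], and [K1] is closed, so [P B Q] maps [K2]
    into [K1] for singular [B] too ([cone_map_of_unit]).  Take [B = u f] of rank
    one, with [u] in [K1] and [f] in the dual cone of [K2]: the vectors
    [f(Q x) P u] lie in [K1] for all [x] in [K2].  One nonzero value of [f(Q x)]
    fixes a sign [s] such that [s P] preserves [K1]; pointedness of [K1] then
    forces [s f(Q x) >= 0] for all [f] and [x], so that [s Q] preserves [K2] by
    the bipolar theorem ([common_sign]).  The same argument for the inverse map
    gives a sign [t] for [Y] and [X], and [t = s]: otherwise [t Y s P = -1]
    would preserve the pointed cone [K1].  Hence [s X] and [s Y] map the cones
    onto themselves. *)

(** * Continuity in matrix spaces *)

Section MatrixTopology.
Variable R : realType.

Lemma continuous_mx (T : topologicalType) m n (F : T -> 'M[R]_(m, n)) :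
  (forall i j, continuous (fun t => F t i j)) -> continuous F.
Proof.
move=> Fc t A [P Pnbhs PA]; rewrite nbhs_simpl /=.
suff: \forall s \near t, forall i j, P i j (F s i j).
  by apply: filterS => s Ps; exact: PA.
by apply: filter_forall => i; apply: filter_forall => j; exact: (Fc i j t).
Qed.

Lemma continuous_sum (T : topologicalType) (I : finType) (F : I -> T -> R) :
  (forall i, continuous (F i)) -> continuous (fun t => \sum_i F i t).
Proof.
move=> Fc t; elim: (index_enum I) => [|i s IHs].
  by under eq_fun do rewrite big_nil; exact: cvg_cst.
under eq_fun do rewrite big_cons.
by apply: cvgD => //; exact: Fc.
Qed.

Lemma continuous_mulmx m n p (A : 'M[R]_(m, n)) :
  continuous (fun M : 'M[R]_(n, p) => A *m M).
Proof.
apply: continuous_mx => i j; under eq_fun do rewrite mxE.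
apply: continuous_sum => k M; apply: (@cvgM _ _ (nbhs M) _ (cst (A i k))); first exact: cvg_cst.
exact: (@coord_continuous R n p k j M).
Qed.

Lemma continuous_trmx m n : continuous (fun M : 'M[R]_(m, n) => M^T).
Proof.
apply: continuous_mx => i j; under eq_fun do rewrite mxE.
exact: coord_continuous.
Qed.

Lemma nbhs_ray n (A : set 'cV[R]_n) (a b : 'cV[R]_n) : nbhs a A ->
  exists2 e, 0 < e & forall t, 0 < t < e -> A (a + t *: b).
Proof.
have cab : continuous (fun t : R => a + t *: b).
  move=> t; apply: (@cvgD _ _ _ (nbhs t) _ (cst a)); first exact: cvg_cst.
  by apply: (@cvgZr_tmp _ _ _ (nbhs t) _ id); exact: cvg_id.
move=> aA; have := cab 0 A; rewrite scale0r addr0 => /(_ aA).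
move=> /nbhs_ballP[e /= e0 eA]; exists e => // t /andP[t0 te]; apply: eA.
by rewrite /ball /= sub0r normrN gtr0_norm.
Qed.

(** The one-sided limit [t --> 0+] is all that the density argument needs, and
    it lets the admissible [t] avoid finitely many values. *)
Lemma closed_ray_limit n (K : set 'cV[R]_n) (a b : 'cV[R]_n) : closed K ->
  (forall e, 0 < e -> exists2 t, 0 < t < e & K (a + t *: b)) -> K a.
Proof.
move=> Kcl Kab; apply: Kcl => A /(nbhs_ray b)[e e0 eA].
by have [t te Kt] := Kab e e0; exists (a + t *: b); split => //; exact: eA.
Qed.

End MatrixTopology.

(** * Separation and duality for closed convex cones *)

Section Duality.
Variables (R : realType) (n : nat).
Implicit Types (K : set 'cV[R]_n) (f : 'rV[R]_n) (u v w x y : 'cV[R]_n).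

(** Functionals are row vectors, so that [f *m B] is the pullback of [f] by
    [B]. *)
Definition dual_cone K : set 'rV[R]_n :=
  [set f | forall x, K x -> 0 <= (f *m x) 0 0].

(** The Euclidean norm is needed because the norm carried by matrices is the
    sup norm, which does not come from an inner product. *)
Definition normsq v : R := (v^T *m v) 0 0.

Lemma normsqE v : normsq v = \sum_i v i 0 ^+ 2.
Proof. by rewrite /normsq mxE; apply: eq_bigr => i _; rewrite mxE expr2. Qed.

Lemma normsq_ge0 v : 0 <= normsq v.
Proof. by rewrite normsqE sumr_ge0// => i _; exact: sqr_ge0. Qed.

Lemma normsq_eq0 v : normsq v = 0 -> v = 0.
Proof.
rewrite normsqE => /eqP; rewrite psumr_eq0 => [/allP v0|i _]; last exact: sqr_ge0.
apply/colP => i; rewrite mxE; apply/eqP; rewrite -sqrf_eq0.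
by apply: (v0 i); rewrite mem_index_enum.
Qed.

Lemma normsqDZ u w (t : R) :
  normsq (u + t *: w) = normsq u + t * (2 * (u^T *m w) 0 0 + t * normsq w).
Proof.
have -> : (u^T *m w) 0 0 = \sum_i u i 0 * w i 0.
  by rewrite mxE; apply: eq_bigr => i _; rewrite mxE.
rewrite !normsqE !mulr_sumr -big_split /= mulr_sumr -big_split /=.
by apply: eq_bigr => i _; rewrite !mxE; ring.
Qed.

Lemma coord_sqr_le_normsq v i : v i 0 ^+ 2 <= normsq v.
Proof.
by rewrite normsqE (bigD1 i)//= lerDl sumr_ge0// => j _; exact: sqr_ge0.
Qed.

(** The candidates that are no farther from [y] than a given point of [K] form
    a closed subset of a box, hence a compact set. *)
Lemma nearest_point K y : closed K -> K !=set0 ->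
  exists2 p, K p & forall x, K x -> normsq (p - y) <= normsq (x - y).
Proof.
move=> Kcl [x0 Kx0].
pose q (r : 'rV[R]_n) := normsq (r^T - y).
have qc : continuous q.
  have -> : q = fun r => \sum_i (r 0 i - y i 0) ^+ 2.
    by apply/funext => r; rewrite /q normsqE; apply: eq_bigr => i _; rewrite !mxE.
  apply: continuous_sum => i r.
  apply: (@continuous_comp _ _ _ (fun r : 'rV[R]_n => r 0 i - y i 0)
    (fun s => s ^+ 2)); last exact: exprn_continuous.
  apply: (@cvgB _ _ _ (nbhs r)); last exact: cvg_cst.
  exact: coord_continuous.
pose A := [set r : 'rV[R]_n | K r^T] `&` (q @^-1` [set s | s <= q x0^T]).
have Acl : closed A.
  apply: closedI; first by apply: preimage_closed => // r _; exact: continuous_trmx.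
  by apply: preimage_closed => [r _|]; [exact: qc | exact: closed_le].
have Aco : compact A.
  (* A coordinate with square at most q0 is at most 1 + q0 in absolute value,
     which avoids square roots. *)
  pose B i := [set` `[y i 0 - (1 + q x0^T), y i 0 + (1 + q x0^T)]%R].
  apply: (subclosed_compact Acl (@rV_compact _ _ B _)) => [i|r [_ /= qr] i].
    exact: segment_compact.
  have := le_trans (coord_sqr_le_normsq (r^T - y) i) qr.
  rewrite !mxE /B /= in_itv /= => h.
  by have := normsq_ge0 (x0^T^T - y); rewrite -/(q _); move: h; nra.
have A0 : A !=set0 by exists x0^T; split; rewrite /= ?trmxK.
have [p /set_mem [Kp qp] pmin] :=
  EVT_min_rV A0 Aco (@continuous_subspaceT _ _ _ _ qc).
exists p^T => // x Kx; have [xq|/ltW xq] := lerP (q x^T) (q x0^T).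
  by have := pmin x^T; rewrite /q trmxK inE; apply; split; rewrite /= ?trmxK.
by rewrite -[x]trmxK; exact: le_trans qp xq.
Qed.

(** The first-order condition at a minimum: a negative slope [b] would win over
    the quadratic term for small [t]. *)
Lemma ge0_of_small_quadratic (b c : R) :
  (forall t, 0 < t < 1 -> 0 <= t * (2 * b + t * c)) -> 0 <= b.
Proof.
move=> h; rewrite leNgt; apply/negP => b0.
have c1 : 0 < 1 + `|c| by rewrite ltr_pwDl.
(* The factor 1 + |c| makes t * c negligible, the factor 1 - b keeps t < 1. *)
pose t := - b / ((1 - b) * (1 + `|c|)).
have d0 : 0 < (1 - b) * (1 + `|c|) by nra.
have t0 : 0 < t by rewrite divr_gt0// oppr_gt0.
have t1 : t < 1.
  by rewrite ltr_pdivrMr// mul1r; have := normr_ge0 c; nra.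
have tc : t * (1 + `|c|) <= - b.
  rewrite /t invfM mulrA -mulrA mulVf ?gt_eqF// mulr1 ler_pdivrMr; nra.
have := h t; rewrite t0 t1 => /(_ isT); rewrite pmulr_rge0//.
have := ler_norm c; nra.
Qed.

Lemma convex_cone0 K : convex_cone K -> K !=set0 -> K 0.
Proof. by move=> [_ KZ] [x Kx]; rewrite -(scale0r x); exact: KZ. Qed.

(** The separating functional is the displacement from [y] to its nearest point
    [p] in [K].  Minimality along the directions of [K] makes it nonnegative on
    [K]; minimality along the segment from [p] to [0] makes it nonpositive
    at [p], hence negative at [y]. *)
Lemma separation K y : convex_cone K -> closed K -> K !=set0 -> ~ K y ->
  exists2 f, dual_cone K f & (f *m y) 0 0 < 0.
Proof.
move=> Kc Kcl Kn0 Ky; have [KD KZ] := Kc.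
have [p Kp pmin] := nearest_point y Kcl Kn0.
pose f := (p - y)^T.
have fge0 w : (forall t, 0 < t < 1 -> K (p + t *: w)) -> 0 <= (f *m w) 0 0.
  move=> Kpw; apply: (@ge0_of_small_quadratic _ (normsq w)) => t t01.
  by have := pmin _ (Kpw t t01); rewrite addrAC normsqDZ lerDl.
exists f.
  move=> x Kx; apply: fge0 => t /andP[t0 _]; apply: KD => //.
  by apply: KZ => //; exact: ltW.
have fp : 0 <= (f *m - p) 0 0.
  apply: fge0 => t /andP[_ t1]; rewrite scalerN -[p in X in K (X - _)]scale1r.
  by rewrite -scalerBl; apply: KZ => //; rewrite subr_ge0 ltW.
have fy : (f *m y) 0 0 = - (f *m - p) 0 0 - normsq (p - y).
  by rewrite /normsq -/f mulmxN mulmxBr !mxE; ring.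
have : normsq (p - y) != 0.
  apply/eqP => /normsq_eq0/eqP; rewrite subr_eq0 => /eqP py.
  by apply: Ky; rewrite -py.
by have := normsq_ge0 (p - y); rewrite fy => ? ?; lra.
Qed.

Lemma bipolar K y : convex_cone K -> closed K -> K !=set0 ->
  (forall f, dual_cone K f -> 0 <= (f *m y) 0 0) -> K y.
Proof.
move=> Kc Kcl Kn0 fy; apply: contrapT => Ky.
have [f /fy] := separation Kc Kcl Kn0 Ky.
by rewrite leNgt => /negP.
Qed.

End Duality.

(** * Proper cones and their duals contain bases *)

Section Nondegeneracy.
Variables (R : realType) (n : nat).
Implicit Types (K : set 'cV[R]_n) (f : 'rV[R]_n) (u v w x y : 'cV[R]_n).

Lemma proper_cone_pointed K x : proper_cone K -> K x -> K (- x) -> x = 0.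
Proof.
move=> [_ _ K0 _] Kx KNx; have : setI K [set - y | y in K] x.
  by split => //; exists (- x) => //; rewrite opprK.
by rewrite K0.
Qed.

Lemma proper_cone_neq0 K : proper_cone K -> K !=set0.
Proof. by move=> [_ _ _ [x /interior_subset Kx]]; exists x. Qed.

Lemma interior_separates K f : interior K !=set0 -> f != 0 ->
  exists2 x, K x & (f *m x) 0 0 != 0.
Proof.
move=> [u uK] f0; have Ku := interior_subset uK.
have [fu|] := eqVneq ((f *m u) 0 0) 0; last by exists u.
have [e e0 eK] := nbhs_ray f^T uK.
exists (u + (e / 2) *: f^T); first by apply: eK; lra.
rewrite mulmxDr -scalemxAr mxE fu add0r mxE mulf_neq0//; first by rewrite gt_eqF// divr_gt0.
by apply: contra_neq f0 => ff; rewrite -[f]trmxK (@normsq_eq0 _ _ f^T) ?trmx0// /normsq trmxK.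
Qed.

(** If the whole dual cone vanished at [x], both [x] and [- x] would lie in the
    bidual, which is [K], against pointedness. *)
Lemma dual_cone_separates K x : proper_cone K -> x != 0 ->
  exists2 f, dual_cone K f & (f *m x) 0 0 != 0.
Proof.
move=> Kp; apply: contra_neqP => nof; have [Kc Kcl _ _] := Kp.
have fx0 f : dual_cone K f -> (f *m x) 0 0 = 0.
  by move=> Kf; apply/eqP; apply: contrapT => /negP fx; apply: nof; exists f.
have Kn0 := proper_cone_neq0 Kp.
apply: (proper_cone_pointed Kp); apply: bipolar => // f /fx0 fx.
  by rewrite fx.
by rewrite mulmxN mxE fx oppr0.
Qed.

(** A separating set of functionals spans the dual space, hence contains a
    basis.  The basis is built row by row: a nonzero vector [r] killed by the
    rows chosen so far is detected by some member of [S], which is thus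
    independent of them. *)
Lemma extract_basis (S : set 'rV[R]_n) :
  (forall x, x != 0 -> exists2 f, S f & (f *m x) 0 0 != 0) ->
  exists2 F : 'M[R]_n, F \in unitmx & forall i, S (row i F).
Proof.
move=> Ssep.
suff h m : (m <= n)%N -> exists2 F : 'M[R]_(m, n), row_free F & forall i, S (row i F).
  by have [F] := h n (leqnn n); rewrite row_free_unit; exists F.
elim: m => [_|m IHm mn].
  exists 0 => [|[]//]; by rewrite -row_leq_rank.
have [F Ffree FS] := IHm (ltnW mn).
have /rowV0Pn[r] : kermx F^T != 0.
  by rewrite -mxrank_eq0 mxrank_ker mxrank_tr (eqP Ffree) subn_eq0 -ltnNge.
move=> /sub_kermxP rF r0.
have Fr : F *m r^T = 0 by rewrite -[LHS]trmxK trmx_mul trmxK rF trmx0.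
have [|f Sf fr] := Ssep r^T; first by apply: contra_neq r0 => /(canRL trmxK); rewrite trmx0.
exists (col_mx f F : 'M[R]_(1 + m, n)); last first.
  move=> i; rewrite -[i](@splitK 1 m); case: (@fintype.split 1 m i) => j /=.
    by rewrite (@rowKu _ 1 m n) ord1 row_id.
  by rewrite (@rowKd _ 1 m n).
apply: (@inj_row_free _ (1 + m)) => v; rewrite -[v](@hsubmxK _ 1 1 m) mul_row_col => vF.
(* Evaluating a linear relation at r isolates the coefficient of the new row. *)
have /(congr1 (fun M => (M *m r^T) 0 0)) := vF.
rewrite mulmxDl -!mulmxA Fr mulmx0 addr0 mul0mx [RHS]mxE mxE big_ord1.
move=> /eqP; rewrite mulf_eq0 (negPf fr) orbF => /eqP l0.
have {}l0 : lsubmx v = 0 by apply/rowP => j; rewrite ord1 l0 mxE.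
move: vF; rewrite l0 mul0mx add0r => vF.
have Finj := row_free_inj Ffree.
by rewrite (Finj _ (rsubmx v) 0) ?mul0mx ?row_mx0.
Qed.

End Nondegeneracy.

(** * Matrices mapping a cone into a cone *)

Section ConeMaps.
Variables (R : realType) (n : nat).
Implicit Types (K : set 'cV[R]_n) (f : 'rV[R]_n) (u v w x y : 'cV[R]_n).
Implicit Types (B M N P Q X Y : 'M[R]_n).

Definition cone_map K K' B := forall x, K x -> K' (B *m x).

(** With [u_i] a basis inside [K'] and [f_i] a basis inside the dual of [K], the
    map [x |-> \sum_i f_i(x) u_i] is invertible and sends [K] into [K']. *)
Lemma exists_unit_cone_map K K' : proper_cone K -> proper_cone K' ->
  exists2 B, B \in unitmx & cone_map K K' B.
Proof.
move=> Kp K'p; have [K'c _ _ K'i] := K'p; have [K'D K'Z] := K'c.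
have [F Funit FK] := extract_basis (fun x => dual_cone_separates Kp (x := x)).
have [x x0|G Gunit GK'] := @extract_basis _ _ (fun f => K' f^T).
  have [|u K'u xu] := interior_separates (f := x^T) K'i.
    by apply: contra_neq x0 => /(canRL trmxK); rewrite trmx0.
  exists u^T; first by rewrite trmxK.
  by rewrite -[x]trmxK -trmx_mul mxE.
exists (G^T *m F) => [|x Kx]; first by rewrite unitmx_mul unitmx_tr Gunit.
rewrite -mulmxA -[G^T *m _]trmxK trmx_mul trmxK mulmx_sum_row linear_sum /=.
elim/big_ind: _ => [||i _]; [|exact: K'D|].
  by apply: convex_cone0 => //; exact: proper_cone_neq0.
rewrite linearZ /=; apply: K'Z => //.
by rewrite mxE -[leRHS]/((F *m x) i 0); have := FK i _ Kx; rewrite -row_mul mxE.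
Qed.

(** [M + t N] is singular only if [- t] is an eigenvalue of [M N^-1], which
    excludes finitely many [t]. *)
Lemma unitmx_perturbation M N e : N \in unitmx -> 0 < e ->
  exists2 t, 0 < t < e & M + t *: N \in unitmx.
Proof.
move=> Nunit e0; pose p := char_poly (M *m invmx N).
have singular_root t : M + t *: N \notin unitmx -> root p (- t).
  rewrite -eigenvalue_root_char -row_free_unit => MtN.
  apply: contraR MtN => neig; apply: inj_row_free => v vMtN.
  apply: contraNeq neig => v0; apply/eigenvalueP; exists v => //.
  rewrite mulmxA; move: vMtN; rewrite mulmxDr => /eqP; rewrite addr_eq0 => /eqP ->.
  by rewrite mulNmx -scalemxAr -scalemxAl mulmxK// scaleNr.
apply: contrapT => nounit.
(* Starting at e / 2 keeps these size p distinct candidates strictly below e. *)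
pose s := [seq - (e / k.+2%:R) | k <- iota 0 (size p)].
have : (size s < size p)%N.
  apply: (max_poly_roots (monic_neq0 (char_poly_monic _))).
    apply/allP => _ /mapP[k _ ->]; apply: singular_root; apply/negP => u.
    apply: nounit; exists (e / k.+2%:R) => //.
    by rewrite divr_gt0//= ltr_pdivrMr// ltr_pMr// ltr1n.
  rewrite map_inj_uniq ?iota_uniq// => j k /oppr_inj /(mulfI (lt0r_neq0 e0)).
  by move=> /invr_inj /eqP; rewrite eqr_nat => /eqP[].
by rewrite size_map size_iota ltnn.
Qed.

(** Perturbing [B] along an invertible [B0] that also maps [K] into [K'] keeps
    it in the convex set of such maps and makes it invertible; closedness of
    [K'] then recovers the conclusion at [B]. *)
Lemma cone_map_of_unit K K' P Q : proper_cone K -> proper_cone K' ->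
  (forall B, B \in unitmx -> cone_map K K' B -> cone_map K K' (P *m B *m Q)) ->
  forall B, cone_map K K' B -> cone_map K K' (P *m B *m Q).
Proof.
move=> Kp K'p PQ B KB x Kx; have [B0 B0unit KB0] := exists_unit_cone_map Kp K'p.
have [[K'D K'Z] K'cl _ _] := K'p.
apply: (closed_ray_limit (b := P *m B0 *m Q *m x)) => // e e0.
have [t te Bt] := unitmx_perturbation B B0unit e0; exists t => //.
have : cone_map K K' (B + t *: B0).
  move=> z Kz; rewrite mulmxDl -scalemxAl; apply: K'D; first exact: KB.
  by apply: K'Z; [case/andP: te => /ltW | exact: KB0].
move=> /(PQ _ Bt)/(_ x Kx).
by rewrite mulmxDr !mulmxDl -scalemxAr -!scalemxAl.
Qed.

Lemma proper_cone_nonzero K : (0 < n)%N -> proper_cone K ->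
  exists2 u, K u & u != 0.
Proof.
move=> n0 [_ _ _ Ki].
have [|u Ku fu] := interior_separates (f := const_mx 1) Ki; last first.
  by exists u => //; apply: contra_neq fu => ->; rewrite mulmx0 mxE.
apply/eqP => /matrixP/(_ 0 (Ordinal n0)).
by rewrite !mxE => /eqP; rewrite oner_eq0.
Qed.

(** Testing the hypothesis on rank one maps [u f] decouples [P] from [Q] up to a
    sign: a fixed nonzero [f0(Q x0)] determines it from the side of [P], and the
    pointedness of [K'] carries it over to [Q]. *)
Lemma common_sign K K' P Q : (0 < n)%N -> proper_cone K -> proper_cone K' ->
  P \in unitmx -> Q \in unitmx ->
  (forall B, B \in unitmx -> cone_map K K' B -> cone_map K K' (P *m B *m Q)) ->
  exists2 s : R, s ^+ 2 = 1 & cone_map K' K' (s *: P) /\ cone_map K K (s *: Q).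
Proof.
move=> n0 Kp K'p Punit Qunit PQ.
have [Kc Kcl _ Ki] := Kp; have [[K'D K'Z] _ _ K'i] := K'p.
have rank1 f u x : dual_cone K f -> K' u -> K x ->
    K' ((f *m Q *m x) 0 0 *: (P *m u)).
  move=> Kf K'u Kx.
  have uf : cone_map K K' (u *m f).
    move=> z Kz; rewrite -mulmxA [f *m z]mx11_scalar mul_mx_scalar.
    by apply: K'Z => //; exact: Kf.
  have := cone_map_of_unit Kp K'p PQ uf Kx.
  by rewrite -!mulmxA [X in u *m X]mx11_scalar mul_mx_scalar -scalemxAr.
have [z _ /(dual_cone_separates Kp)[f0 Kf0 f0z]] := proper_cone_nonzero n0 Kp.
have f0Q : f0 *m Q != 0.
  apply: contra_neq f0z => /(congr1 (mulmx^~ (invmx Q))).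
  by rewrite mulmxK// mul0mx => ->; rewrite mul0mx mxE.
have [x0 Kx0] := interior_separates Ki f0Q.
set c := (_ *m _) 0 0 => c0.
have [u0 K'u0 u0z] := proper_cone_nonzero n0 K'p.
have Pu0 : P *m u0 != 0.
  apply: contra_neq u0z => /(congr1 (mulmx (invmx P))).
  by rewrite mulKmx// mulmx0.
have PK : cone_map K' K' (Num.sg c *: P).
  move=> u K'u; rewrite -scalemxAl.
  have -> : Num.sg c = `|c|^-1 * c.
    by rewrite {3}[c]numEsg mulrCA mulVf ?mulr1 ?normr_eq0.
  by rewrite -scalerA; apply: K'Z; [rewrite invr_ge0|exact: rank1].
exists (Num.sg c); first by rewrite sqr_sg c0.
split=> // x Kx; apply: bipolar => //; first exact: proper_cone_neq0.
move=> f Kf; rewrite -scalemxAl -scalemxAr mxE mulmxA leNgt; apply/negP.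
set d := (f *m Q *m x) 0 0 => sd.
have := PK _ K'u0; rewrite -scalemxAl.
(* If s and d = f(Q x) had opposite signs, then d P u0 would put - s P u0 in
   K', which already contains s P u0. *)
have K'd : K' (- (Num.sg c *: (P *m u0))).
  have /(K'Z (- (Num.sg c * d))^-1) := rank1 _ _ _ Kf K'u0 Kx.
  rewrite -/d scalerA => h; rewrite -scaleNr.
  have -> : - Num.sg c = (- (Num.sg c * d))^-1 * d.
    have d0 : d != 0 by apply: contraTneq sd => ->; rewrite mulr0 ltxx.
    rewrite invrN invfM mulNr -mulrA mulVf// mulr1; congr (- _).
    by apply: invr_inj; rewrite invrK; case: sgrP c0 => // _ _; rewrite ?invrN invr1.
  by apply: h; rewrite invr_ge0 oppr_ge0 ltW.
move=> /(proper_cone_pointed K'p)/(_ K'd)/eqP.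
by rewrite scaler_eq0 (negPf Pu0) orbF sgr_eq0 (negPf c0).
Qed.

Lemma mximage_eq K M N : M *m N = 1%:M ->
  cone_map K K M -> cone_map K K N -> mximage M K = K.
Proof.
move=> MN KM KN; apply/seteqP; split=> [_ [x Kx <-]|x Kx]; first exact: KM.
by exists (N *m x); [exact: KN | rewrite mulmxA MN mul1mx].
Qed.

(** A functional vanishing on the range of [M] vanishes on [M K = K], which has
    nonempty interior. *)
Lemma mximage_unitmx K M : interior K !=set0 -> mximage M K = K -> M \in unitmx.
Proof.
move=> Ki MK; rewrite -row_free_unit; apply: inj_row_free => v vM.
apply: contrapT => /eqP /(interior_separates Ki)[x].
by rewrite -MK => -[y _ <-]; rewrite mulmxA vM mul0mx mxE eqxx.
Qed.

(** Semipositivity is automatic: [A^-1] sends an interior point of [K2] to an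
    interior point of [K1], because the preimage of [K2] under [A] is a
    neighbourhood of it contained in [K1]. *)
Lemma MSP K1 K2 A : interior K2 !=set0 ->
  MS K1 K2 A <-> A \in unitmx /\ cone_map K2 K1 (invmx A).
Proof.
move=> [z zK2]; split=> [[_ [B BA BK]]|[Aunit KVA]].
  have [_ Aunit] := mulmx1_unit BA; split=> // x Kx.
  have -> : invmx A = B by rewrite -[B](mulmxK Aunit) BA mul1mx.
  by apply: BK; exists x.
split; last first.
  by exists (invmx A); [exact: mulVmx | move=> _ [x Kx <-]; exact: KVA].
exists (invmx A *m z); last by rewrite mulKVmx.
rewrite /interior /=.
have : nbhs (A *m (invmx A *m z)) K2 by rewrite mulKVmx.
move=> /(@continuous_mulmx _ _ _ _ A (invmx A *m z) K2).
rewrite nbhs_simpl /=; apply: (@filterS _ (nbhs (invmx A *m z))) => x /KVA.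
by rewrite mulKmx.
Qed.

Lemma unit_image_MS K1 K2 X Y : interior K2 !=set0 ->
  X \in unitmx -> Y \in unitmx ->
  [set X *m A *m Y | A in MS K1 K2] = MS K1 K2 <->
  (forall B, B \in unitmx ->
    cone_map K2 K1 B <-> cone_map K2 K1 (invmx Y *m B *m invmx X)).
Proof.
move=> K2i Xunit Yunit.
have inv_XAY A : A \in unitmx ->
    invmx (X *m A *m Y) = invmx Y *m invmx A *m invmx X.
  move=> Aunit; have XAYunit : X *m A *m Y \in unitmx.
    by rewrite !unitmx_mul Xunit Aunit.
  by rewrite -[RHS](mulmxK XAYunit) !mulmxA mulmxKV// mulmxKV// mulVmx// mul1mx.
have MSV B : B \in unitmx -> MS K1 K2 (invmx B) <-> cone_map K2 K1 B.
  by move=> Bunit; rewrite MSP// invmxK unitmx_inv Bunit; split=> [[]|].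
have MSXAY A : A \in unitmx -> MS K1 K2 (X *m A *m Y) <->
    cone_map K2 K1 (invmx Y *m invmx A *m invmx X).
  by move=> Aunit; rewrite MSP// inv_XAY// !unitmx_mul Xunit Yunit Aunit; split=> [[]|].
have imK A : X *m (invmx X *m A *m invmx Y) *m Y = A.
  by rewrite !mulmxA mulmxV// mul1mx mulmxKV.
split=> [LMS B Bunit|PQ].
  have VBunit : invmx B \in unitmx by rewrite unitmx_inv.
  rewrite -MSV// -{2}[B]invmxK -MSXAY//; split=> [MSB|].
    by rewrite -LMS; exists (invmx B).
  rewrite -{1}LMS => -[A MSA /(congr1 (fun M => invmx X *m M *m invmx Y))].
  by rewrite !mulmxA !mulVmx// !mul1mx !mulmxK// => <-.
apply/seteqP; split=> [_ [A MSA <-]|A MSA].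
  have [Aunit KVA] := (MSP _ _ K2i).1 MSA.
  by apply/(MSXAY _ Aunit)/(PQ _ _).1; rewrite ?unitmx_inv.
have [Aunit _] := (MSP _ _ K2i).1 MSA.
exists (invmx X *m A *m invmx Y); last exact: imK.
have Cunit : invmx X *m A *m invmx Y \in unitmx.
  by rewrite !unitmx_mul !unitmx_inv Xunit Aunit.
apply/MSP => //; split=> //; apply/(PQ _ _).2; first by rewrite unitmx_inv.
by apply/(MSXAY _ Cunit); rewrite imK.
Qed.

End ConeMaps.

Theorem corollary3p36 (R : realType) (n : nat) (hn : (2 <= n)%N)
    (K1 K2 : set 'cV[R]_n) (hK1 : proper_cone K1) (hK2 : proper_cone K2)
    (X Y : 'M[R]_n) (L : {linear 'M[R]_n -> 'M[R]_n})
    (hL : forall A : 'M[R]_n, L A = X *m A *m Y) :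
  L @` MS K1 K2 = MS K1 K2 <->
  (mximage X K2 = K2 /\ mximage Y K1 = K1) \/
  (mximage (- X) K2 = K2 /\ mximage (- Y) K1 = K1).
Proof.
have [_ _ _ K1i] := hK1; have [_ _ _ K2i] := hK2.
have n0 : (0 < n)%N by exact: ltnW.
have -> : L @` MS K1 K2 = [set X *m A *m Y | A in MS K1 K2].
  by apply: eq_imagel => A _; exact: hL.
split=> [LMS|].
  have [Xunit Yunit] : X \in unitmx /\ Y \in unitmx.
    have [B Bunit KB] := exists_unit_cone_map hK2 hK1.
    have : MS K1 K2 (invmx B) by rewrite MSP// invmxK unitmx_inv.
    rewrite -LMS => -[A _ XAY].
    have : X *m A *m Y \in unitmx by rewrite XAY unitmx_inv.
    by rewrite !unitmx_mul => /andP[/andP[]].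
  have VXunit : invmx X \in unitmx by rewrite unitmx_inv.
  have VYunit : invmx Y \in unitmx by rewrite unitmx_inv.
  have equiv := (unit_image_MS K1 K2i Xunit Yunit).1 LMS.
  have [s s1 [sVY sVX]] := common_sign n0 hK2 hK1 VYunit VXunit
    (fun B Bu => (equiv B Bu).1).
  have [|t t1 [tY tX]] := common_sign n0 hK2 hK1 Yunit Xunit.
    move=> B Bunit KB; apply/equiv; first by rewrite !unitmx_mul Yunit Bunit.
    by rewrite !mulmxA mulVmx// mul1mx mulmxK.
  have ts : t = s.
    have [u K1u] := proper_cone_nonzero n0 hK1; apply: contraNeq => ts.
    have tsN : t * s = -1.
      move/eqP: s1; move/eqP: t1; rewrite !sqrf_eq1.
      by move=> /orP[]/eqP tE /orP[]/eqP sE; move: ts; rewrite tE sE ?eqxx//; lra.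
    (* Composing t Y with s Y^-1 gives t s = -1 times the identity on K1. *)
    apply/eqP/(proper_cone_pointed hK1 K1u); have := tY _ (sVY _ K1u).
    by rewrite -!scalemxAl -scalemxAr mulKVmx// scalerA tsN scaleN1r.
  move: tY tX sVY sVX; rewrite {}ts => tY tX sVY sVX.
  move/eqP: s1; rewrite sqrf_eq1 => /orP[]/eqP sE; [left|right].
    rewrite sE !scale1r in tX tY sVX sVY.
    by split; [apply: mximage_eq tX sVX | apply: mximage_eq tY sVY];
      rewrite mulmxV.
  rewrite sE !scaleN1r in tX tY sVX sVY.
  by split; [apply: mximage_eq tX sVX | apply: mximage_eq tY sVY];
    rewrite mulmxN mulNmx opprK mulmxV.
have image_eq (X' Y' : 'M[R]_n) : mximage X' K2 = K2 -> mximage Y' K1 = K1 ->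
    [set X' *m A *m Y' | A in MS K1 K2] = MS K1 K2.
  move=> XK YK; have Xunit := mximage_unitmx K2i XK.
  have Yunit := mximage_unitmx K1i YK.
  apply/unit_image_MS => // B Bunit; split=> KB x.
    rewrite -{1}XK => -[y Ky <-]; rewrite -!mulmxA mulKmx//.
    have : K1 (B *m y) by exact: KB.
    by rewrite -{1}YK => -[z Kz <-]; rewrite mulKmx.
  move=> Kx; have : K2 (X' *m x) by rewrite -XK; exists x.
  move=> /KB; rewrite -!mulmxA mulKmx// => K1Bx.
  by rewrite -[B *m x](mulKVmx Yunit) -YK; exists (invmx Y' *m (B *m x)).
move=> [[XK YK]|[XK YK]]; first exact: image_eq.
rewrite -[RHS](image_eq _ _ XK YK); apply: eq_imagel => A _.
by rewrite mulmxN !mulNmx opprK.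
Qed.
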